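(* Let $\gamma\in\left(0,\frac{2}{L_{\max}}\right)$. Suppose that each $X_i$ is non-empty, compact and convex; that the functions $f_i$, $i\in\{1,\ldots,N\}$, and $c$ are convex and twice continuously differentiable; that each set $K^i$ is infinite and, for all $i$ and all $j\neq i$, $\lim_{d\to\infty}\tau^i_j(k_d)=\infty$ for every sequence $\{k_d\}_{d\in\mathbb{N}}$ in $K^i$ tending to infinity; and that the sets $$X(s)=\left\{y\in X:\Vert y-\hat{x}_A\Vert_{\max}\leq q^sD_o\right\},\qquad s\in\mathbb{N}=\{0,1,2,\ldots\},$$ satisfy: 1. $\cdots\subset X(s+1)\subset X(s)\subset\cdots\subset X$; 2. $\lim_{s\to\infty}X(s)=\{\hat{x}_A\}$; 3. for all $i$ and $s$ there is $X_i(s)\subset X_i$ such that $X(s)=X_1(s)\times\cdots\times X_N(s)$; 4. for all $s$, all $y\in X(s)$ and all $i$, $\theta_i(y):=y_i-\gamma\nabla_if_A(y)\in X_i(s+1)$. Let the agents execute the asynchronous update law $$x^i_i(k+1)=\begin{cases}x^i_i(k)-\gamma\nabla_if_A(x^i(k)) & k\in K^i\\ x^i_i(k) & k\notin K^i\end{cases}$$ $$x^i_j(k+1)=\begin{cases}x^j_j\left(\tau^i_j(k+1)\right) & \text{if agent } i \text{ receives agent } j\text{'s state at time } k+1\\ x^i_j(k) & \text{otherwise}\end{cases}$$ for all $i\in\{1,\ldots,N\}$ and $j\neq i$. At time $k$, if $c(k)$ communication cycles have been completed, then $$\left\Vert x^i(k)-\hat{x}_A\right\Vert_{\max}\leq q^{c(k)}D_o$$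 for all $i\in\{1,\ldots,N\}$.
   Context: Setting. There are $N$ agents, indexed by $i\in\{1,\ldots,N\}$, with constraint sets $X_i\subset\mathbb{R}^{n_i}$; $X:=X_1\times\cdots\times X_N\subset\mathbb{R}^n$, $n=\sum_in_i$. Vectors $x\in\mathbb{R}^n$ are written in blocks $x=(x_1^T,\ldots,x_N^T)^T$, $x_i\in\mathbb{R}^{n_i}$. With real-valued functions $f_i$ of $x_i\in\mathbb{R}^{n_i}$ and $c$ of $x\in\mathbb{R}^n$ (the coupling cost $c(x)$ is unrelated to the cycle count $c(k)$), put $f(x):=c(x)+\sum_{i=1}^Nf_i(x_i)$; $\nabla f$ is Lipschitz and $f$ is assumed to have a unique minimizer over $X$. Regularization. Each agent $i$ chooses $\alpha_i>0$ (the $\alpha_i$ may differ). With $A=\mathrm{diag}(\alpha_1I_{n_1},\ldots,\alpha_NI_{n_N})$ set $f_A(x):=f(x)+\frac12x^TAx$, and $\hat{x}_A:=\arg\min_{x\in X}f_A(x)$. Write $\nabla_if_A:=\frac{\partial f_A}{\partial x_i}$, let $L_i$ be the Lipschitz constant of $\nabla_if_A$ and $L_{\max}:=\max_iL_i$. It is assumed that $\alpha_i\in(0,L_{\max})$ for all $i$. Norm. For fixed $w_i\geq1$ and $p_i\in[1,\infty]$, let $\Vert x\Vert_{\max}:=\max_i\frac{\Vert x_i\Vert_{p_i}}{w_i}$. Constants. $q=\max\left\{\max_i|1-\gamma\alpha_i|,\ \max_i|1-\gamma L_i|\right\}$, which is taken to lie in $(0,1)$, and $D_o:=\max_i\Vert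 x^i(0)-\hat{x}_A\Vert_{\max}$. Asynchronous states. Time is discrete, $k=0,1,2,\ldots$. Agent $i$ stores a full state vector $x^i(k)\in\mathbb{R}^n$ with blocks $x^i_j(k)\in\mathbb{R}^{n_j}$: $x^i_i(k)$ is its own state, and $x^i_j(k)$, $j\neq i$, is its stored (possibly outdated) copy of agent $j$'s state. Initial vectors satisfy $x^i(0)\in X$. $K^i$ is the set of times at which agent $i$ computes an update of $x^i_i$. $\tau^i_j(k)$ is the time at which the value $x^i_j(k)$ was originally computed by agent $j$ (so $\tau^i_j(k)\leq k$). Communication cycles. Starting at time $k=0$, one cycle is completed when every agent has calculated a state update and this updated state has been sent to and received by each other agent. Once a cycle is completed the next one begins, and is completed in the same way (every agent has calculated a new state update since the completion of the previous cycle and that update has been received by each other agent), and so on. $c(k)$ denotes the number of cycles completed by time $k$. Inclusions $\subset$ are not necessarily strict, and for a nested decreasing sequence of sets $\lim_{s\to\infty}X(s)$ means $\bigcap_sX(s)$.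
   Formalization: The formal theorem also assumes that messages do not overtake: τ^i_j(k) ≤ τ^i_j(k+1), so a stored copy is never replaced by an older one; without this, a late old message received after a completed cycle violates the bound. *)

(* Defs.v *)
(* Vectors of R^n are row vectors; x^T A x is written x *m A *m x^T. *)
From HB Require Import structures.
From mathcomp Require Import all_boot all_order all_algebra.
From mathcomp Require Import all_classical all_reals all_analysis.

Set Implicit Arguments.
Unset Strict Implicit.
Unset Printing Implicit Defensive.

Import Order.TTheory GRing.Theory Num.Theory.
Import numFieldNormedType.Exports.

Local Open Scope classical_set_scope.
Local Open Scope ring_scope.

(* ℓ^p norm for p in [1, +oo]; the value at p = -oo is junk. *)
Definition pnorm (R : realType) (m : nat) (p : \bar R) (v : 'rV[R]_m) : R :=
  match p with
  | EFin r => (\sum_(j < m) `|v 0 j| `^ r) `^ r^-1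
  | _ => \big[Num.max/0]_(j < m) `|v 0 j|
  end.

Definition gradient (R : realType) (m : nat) (g : 'rV[R]_m -> R)
    (x : 'rV[R]_m) : 'rV[R]_m :=
  \row_(j < m) 'D_(delta_mx 0 j) g x.

(* The Jacobian of the gradient is the Hessian. *)
Definition twice_cont_diff (R : realType) (m : nat) (g : 'rV[R]_m -> R) : Prop :=
  [/\ forall x, differentiable g x,
      forall x, differentiable (gradient g) x &
      continuous (jacobian (gradient g))].

Definition convex_on_Rn (R : realType) (m : nat) (g : 'rV[R]_m -> R) : Prop :=
  convex_function (setT : set (convex_lmodType 'rV[R]_m)) g.

Definition lipschitz_cst (R : realType) (m l : nat)
    (g : 'rV[R]_m -> 'rV[R]_l) (L : R) : Prop :=
  forall x y, pnorm 2%:E (g x - g y) <= L * pnorm 2%:E (x - y).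

Definition minimizer (R : realType) (T : Type) (X : set T) (g : T -> R) (x : T) :
    Prop :=
  X x /\ forall y, X y -> g x <= g y.

(* Block i of x : 'rV_(\sum_i n i) is submxrow x i. *)
Definition block_prod (R : realType) (N : nat) (n : 'I_N -> nat)
    (Y : forall i, set 'rV[R]_(n i)) : set 'rV[R]_(\sum_i n i) :=
  [set y | forall i, Y i (submxrow y i)].

Definition max_over (R : realType) (N : nat) (a : 'I_N -> R) : R :=
  \big[Num.max/0]_(i < N) a i.

Definition block_max_norm (R : realType) (N : nat) (n : 'I_N -> nat)
    (w : 'I_N -> R) (p : 'I_N -> \bar R) (x : 'rV[R]_(\sum_i n i)) : R :=
  max_over (fun i => pnorm (p i) (submxrow x i) / w i).

Definition cost (R : realType) (N : nat) (n : 'I_N -> nat)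
    (f_ : forall i, 'rV[R]_(n i) -> R) (c : 'rV[R]_(\sum_i n i) -> R)
    (x : 'rV[R]_(\sum_i n i)) : R :=
  c x + \sum_(i < N) f_ i (submxrow x i).

Definition reg_cost (R : realType) (N : nat) (n : 'I_N -> nat)
    (f : 'rV[R]_(\sum_i n i) -> R) (alpha : 'I_N -> R)
    (x : 'rV[R]_(\sum_i n i)) : R :=
  let A : 'M[R]_(\sum_i n i) := \mxdiag_(i < N) ((alpha i)%:M : 'M[R]_(n i)) in
  f x + 2^-1 * (x *m A *m x^T) 0 0.

Definition gradient_block (R : realType) (N : nat) (n : 'I_N -> nat)
    (g : 'rV[R]_(\sum_i n i) -> R) (i : 'I_N) (x : 'rV[R]_(\sum_i n i)) :
    'rV[R]_(n i) :=
  submxrow (gradient g x) i.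

Definition gradient_step (R : realType) (N : nat) (n : 'I_N -> nat)
    (g : 'rV[R]_(\sum_i n i) -> R) (gamma : R) (i : 'I_N)
    (x : 'rV[R]_(\sum_i n i)) : 'rV[R]_(n i) :=
  submxrow x i - gamma *: gradient_block g i x.

Definition rate (R : realType) (N : nat) (gamma : R) (alpha L : 'I_N -> R) : R :=
  Num.max (max_over (fun i => `|1 - gamma * alpha i|))
          (max_over (fun i => `|1 - gamma * L i|)).

Definition level_set (R : realType) (N : nat) (n : 'I_N -> nat)
    (X : set 'rV[R]_(\sum_i n i)) (nrm : 'rV[R]_(\sum_i n i) -> R)
    (xhat : 'rV[R]_(\sum_i n i)) (q D : R) (s : nat) :
    set 'rV[R]_(\sum_i n i) :=
  [set y | X y /\ nrm (y - xhat) <= q ^+ s * D].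

(* recv i j k : agent i receives agent j's state at time k. *)
Definition update_law (R : realType) (N : nat) (n : 'I_N -> nat)
    (theta : forall i, 'rV[R]_(\sum_i n i) -> 'rV[R]_(n i))
    (K : 'I_N -> set nat) (recv : 'I_N -> 'I_N -> set nat)
    (tau : 'I_N -> 'I_N -> nat -> nat)
    (x : 'I_N -> nat -> 'rV[R]_(\sum_i n i)) : Prop :=
  (forall i k,
     (K i k -> submxrow (x i k.+1) i = theta i (x i k)) /\
     (~ K i k -> submxrow (x i k.+1) i = submxrow (x i k) i)) /\
  (forall i j k, j != i ->
     (recv i j k.+1 ->
        submxrow (x i k.+1) j = submxrow (x j (tau i j k.+1)) j) /\
     (~ recv i j k.+1 -> submxrow (x i k.+1) j = submxrow (x i k) j)).

(* tau i j k is the time at which agent i's copy of agent j's state was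
   originally computed by agent j.  The result of the update performed at
   u \in K j is the state at time u.+1, so an origin time is 0 (an initial
   value) or such a u.+1; it is unchanged while the copy is kept. *)
Definition origin_times (N : nat) (K : 'I_N -> set nat)
    (recv : 'I_N -> 'I_N -> set nat) (tau : 'I_N -> 'I_N -> nat -> nat) : Prop :=
  forall i j k, j != i ->
    [/\ (tau i j k <= k)%N,
        tau i j k = 0%N \/ (exists2 u, K j u & tau i j k = u.+1) &
        ~ recv i j k.+1 -> tau i j k.+1 = tau i j k].

(* A received state is never older than the copy it replaces. *)
Definition in_order (N : nat) (tau : 'I_N -> 'I_N -> nat -> nat) : Prop :=
  forall i j k, j != i -> (tau i j k <= tau i j k.+1)%N.

(* The cycle started at time t is complete at time k. *)
Definition cycle_complete (N : nat) (K : 'I_N -> set nat)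
    (recv : 'I_N -> 'I_N -> set nat) (tau : 'I_N -> 'I_N -> nat -> nat)
    (t k : nat) : Prop :=
  forall i, exists u, [/\ K i u, (t <= u < k)%N &
    forall j, j != i ->
      exists r, [/\ (r <= k)%N, recv j i r & tau j i r = u.+1]].

(* Number of cycles completed by time k, and start time of the current one. *)
Fixpoint cycle_state (N : nat) (K : 'I_N -> set nat)
    (recv : 'I_N -> 'I_N -> set nat) (tau : 'I_N -> 'I_N -> nat -> nat)
    (k : nat) : nat * nat :=
  if k is k'.+1 then
    let ct := cycle_state K recv tau k' in
    if `[< cycle_complete K recv tau ct.2 k >] then (ct.1.+1, k) else ct
  else (0%N, 0%N).

Definition cycles (N : nat) (K : 'I_N -> set nat)
    (recv : 'I_N -> 'I_N -> set nat) (tau : 'I_N -> 'I_N -> nat -> nat)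
    (k : nat) : nat :=
  (cycle_state K recv tau k).1.

(* Main.v *)
Require Import Defs.
From HB Require Import structures.
From mathcomp Require Import all_boot all_order all_algebra.
From mathcomp Require Import all_classical all_reals all_analysis.

Import Order.TTheory GRing.Theory Num.Theory.
Import numFieldNormedType.Exports.

Local Open Scope classical_set_scope.
Local Open Scope ring_scope.

(** This is the asynchronous convergence theorem of Bertsekas for nested boxes,
    run with cycles as the unit of progress.  Membership in a box is checked
    block by block, so a vector assembled from blocks computed at different
    times lies in a box as soon as each of its blocks does.

    Suppose that from time [t] on all agents' vectors lie in the box of level
    [s].  An update made at [u >= t] puts the agent's own block in level
    [s + 1], and no later step takes it out: an own block changes only by an
    update, and later updates also start from a vector in level [s]
    ([own_block_in_next_level]).  When a cycle is complete, every agent holds,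
    for each other agent, a copy at least as recent as such an update, because
    copies are never replaced by older ones.  Hence from then on all blocks of
    all vectors are in level [s + 1] ([cycle_complete_next_level]).  Induction
    on time along [cycle_state] gives level [cycles k] at time [k]
    ([in_cycles_level]), and membership in the level set is the claimed bound. *)

Section AsynchronousBoxes.

Context (R : realType) (N : nat) (n : 'I_N -> nat).
Context (theta : forall i, 'rV[R]_(\sum_i n i) -> 'rV[R]_(n i)).
Context (K : 'I_N -> set nat) (recv : 'I_N -> 'I_N -> set nat).
Context (tau : 'I_N -> 'I_N -> nat -> nat).
Context (x : 'I_N -> nat -> 'rV[R]_(\sum_i n i)).
Context (S : forall i, nat -> set 'rV[R]_(n i)).

Let box (s : nat) := block_prod (fun i => S i s).

Hypothesis tauP : origin_times K recv tau.
Hypothesis xP : update_law theta K recv tau x.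

(** A copy that was never received is an initial value, which need not agree
    with its owner's initial value; only a positive origin time guarantees that
    the copy is a past state of the owner. *)
Lemma copy_origin i j k : j != i ->
  submxrow (x i k) j = submxrow (x j (tau i j k)) j \/
  (submxrow (x i k) j = submxrow (x i 0%N) j /\ tau i j k = 0%N).
Proof.
move=> ji; elim: k => [|k IHk].
  by right; split=> //; have [+ _ _] := tauP i j 0%N ji; rewrite leqn0 => /eqP.
have [_ _ tau_kept] := tauP i j k ji; have [rcv kept] := xP.2 i j k ji.
have [/rcv|nrcv] := pselect (recv i j k.+1); first by left.
by rewrite (kept nrcv) (tau_kept nrcv).
Qed.

Hypothesis S_nested : forall i s, S i s.+1 `<=` S i s.
Hypothesis theta_next : forall s y i, box s y -> S i s.+1 (theta i y).

Lemma in_level0 : (forall i, box 0 (x i 0%N)) -> forall i k, box 0 (x i k).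
Proof.
move=> x0.
have copies k : (forall l, (l <= k)%N -> forall j, S j 0 (submxrow (x j l) j)) ->
    forall i, box 0 (x i k).
  move=> own i j; have [->|ji] := eqVneq j i; first exact: own.
  have [tau_le _ _] := tauP i j k ji.
  by have [->|[-> _]] := copy_origin i j k ji; [exact: own | exact: x0].
(* A copy may be as recent as the current time, so the own blocks of all agents
   are controlled before any copy is. *)
suff own k l : (l <= k)%N -> forall j, S j 0 (submxrow (x j l) j).
  by move=> i k; apply: copies => l; exact: own.
elim: k l => [|k IHk] l; first by rewrite leqn0 => /eqP -> j; exact: x0.
rewrite leq_eqVlt ltnS => /predU1P[-> j|]; last exact: IHk.
have [upd idle] := xP.1 j k.
have [/upd ->|/idle ->] := pselect (K j k); last exact: IHk.
by apply: S_nested; apply: theta_next; exact: copies.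
Qed.

Lemma own_block_in_next_level s i u :
  (forall k, (u <= k)%N -> box s (x i k)) -> K i u ->
  forall k, (u < k)%N -> S i s.+1 (submxrow (x i k) i).
Proof.
move=> xs Ku; elim=> [//|k IHk]; rewrite ltnS => uk.
have [upd idle] := xP.1 i k.
have [/upd ->|nKk] := pselect (K i k); first by apply: theta_next; exact: xs.
rewrite (idle nKk); apply: IHk; rewrite ltn_neqAle uk andbT.
by apply/eqP => ku; rewrite -ku in nKk.
Qed.

Hypothesis tau_mono : in_order tau.

Lemma origin_nondecreasing i j : j != i ->
  {homo tau i j : k l / (k <= l)%N}.
Proof.
by move=> ji; apply: homo_leq => [k|l k m|k]; [|exact: leq_trans|exact: tau_mono].
Qed.

Lemma cycle_complete_next_level s t t' :
  (forall i k, (t <= k)%N -> box s (x i k)) ->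
  cycle_complete K recv tau t t' ->
  forall i k, (t' <= k)%N -> box s.+1 (x i k).
Proof.
move=> xs cyc i k t'k j.
have [u [Ku /andP[tu ut'] sent]] := cyc j.
have own : forall l, (u < l)%N -> S j s.+1 (submxrow (x j l) j).
  by apply: own_block_in_next_level => // l ul; apply/xs/(leq_trans tu).
have [<-|ij] := eqVneq j i; first by apply: own; exact: leq_trans t'k.
have [|r [rt' _ tau_r]] := sent i; first by rewrite eq_sym.
have tau_k : (u < tau i j k)%N.
  by rewrite -tau_r; apply: origin_nondecreasing => //; exact: leq_trans t'k.
have [->|[_ tau0]] := copy_origin i j k ij; first exact: own.
by rewrite tau0 in tau_k.
Qed.

(** The induction carries the whole future of the current cycle's start, since
    an update made during the cycle must be known to persist until, and after,
    the cycle completes. *)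
Lemma in_cycles_level : (forall i, box 0 (x i 0%N)) ->
  forall i k, box (cycles K recv tau k) (x i k).
Proof.
move=> x0.
suff H k : ((cycle_state K recv tau k).2 <= k)%N /\
    forall i l, ((cycle_state K recv tau k).2 <= l)%N ->
      box (cycle_state K recv tau k).1 (x i l).
  by move=> i k; have [start_le] := H k; apply.
elim: k => [|k [start_le IHk]] /=.
  by split=> // i l _; exact: in_level0.
case: ifPn => [/asboolP cyc|_] /=; last by split=> //; exact: leqW.
by split=> //; exact: cycle_complete_next_level cyc.
Qed.

End AsynchronousBoxes.

(** The point [y] supplies the blocks other than the [i]-th; if a factor were
    empty, the inclusion of the boxes would say nothing about the others. *)
Lemma block_prod_subset (R : realType) (N : nat) (n : 'I_N -> nat)
    (Y Z : forall i, set 'rV[R]_(n i)) (y : 'rV[R]_(\sum_i n i)) :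
  block_prod Y y -> block_prod Y `<=` block_prod Z ->
  forall i, Y i `<=` Z i.
Proof.
move=> Yy YZ i v Yv.
(* [B] has [v] as block [i] and agrees with [y] elsewhere. *)
pose B j : 'rV[R]_(n j) := if pselect (i = j) is left ij
  then ecast j 'rV[R]_(n j) ij v else submxrow y j.
have Bi : B i = v.
  by rewrite /B; case: pselect => // ii; rewrite eq_axiomK.
have /YZ/(_ i) : block_prod Y (\mxrow_j B j).
  move=> j; rewrite mxrowK /B; case: pselect => [ij|_]; last exact: Yy.
  by case: _ / ij.
by rewrite mxrowK Bi.
Qed.

Theorem theorem2 (R : realType) (N : nat) (n : 'I_N -> nat)
    (X_ : forall i, set 'rV[R]_(n i))
    (f_ : forall i, 'rV[R]_(n i) -> R) (c : 'rV[R]_(\sum_i n i) -> R)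
    (alpha L w : 'I_N -> R) (p : 'I_N -> \bar R) (gamma : R)
    (xhat : 'rV[R]_(\sum_i n i))
    (Xs_ : forall i, nat -> set 'rV[R]_(n i))
    (K : 'I_N -> set nat) (recv : 'I_N -> 'I_N -> set nat)
    (tau : 'I_N -> 'I_N -> nat -> nat)
    (x : 'I_N -> nat -> 'rV[R]_(\sum_i n i)) :
  let X := block_prod X_ in
  let f := cost f_ c in
  let fA := reg_cost f alpha in
  let Lmax := max_over L in
  let nrm := block_max_norm w p in
  let q := rate gamma alpha L in
  let D0 := max_over (fun i => nrm (x i 0%N - xhat)) in
  let Xs := level_set X nrm xhat q D0 in
  let theta := gradient_step fA gamma in
  (* problem data *)
  (forall i, X_ i !=set0) ->
  (forall i, compact (X_ i)) ->
  (forall i, convex_set (X_ i)) ->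
  (forall i, convex_on_Rn (f_ i)) -> convex_on_Rn c ->
  (forall i, twice_cont_diff (f_ i)) -> twice_cont_diff c ->
  (exists Lf, lipschitz_cst (gradient f) Lf) ->
  (exists! y, minimizer X f y) ->
  (* regularization, constants and norm *)
  minimizer X fA xhat ->
  (forall i, lipschitz_cst (gradient_block fA i) (L i)) ->
  (forall i, 0 < alpha i < Lmax) ->
  (forall i, 1 <= w i) ->
  (forall i, (1 <= p i)%E) ->
  0 < gamma < 2 / Lmax ->
  0 < q < 1 ->
  (* updates and communications *)
  (forall i, infinite_set (K i)) ->
  (forall i j (kd : nat -> nat), j != i -> (forall d, K i (kd d)) ->
     kd @ \oo --> \oo -> (fun d => tau i j (kd d)) @ \oo --> \oo) ->
  origin_times K recv tau ->
  in_order tau ->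
  (* the nested sets *)
  (forall s, Xs s.+1 `<=` Xs s /\ Xs s `<=` X) ->
  \bigcap_s Xs s = [set xhat] ->
  (forall i s, Xs_ i s `<=` X_ i) ->
  (forall s, Xs s = block_prod (fun i => Xs_ i s)) ->
  (forall s y i, Xs s y -> Xs_ i s.+1 (theta i y)) ->
  (* the algorithm *)
  (forall i, X (x i 0%N)) ->
  update_law theta K recv tau x ->
  forall i k, nrm (x i k - xhat) <= q ^+ cycles K recv tau k * D0.
Proof.
move=> X f fA Lmax nrm q D0 Xs theta _ _ _ _ _ _ _ _ _ _ _ _ _ _ _ _ _ _.
move=> tauP tau_mono Xs_nested Xs_cap _ XsE theta_next x0 xP i k.
have Xs_xhat s : Xs s xhat.
  by have : (\bigcap_s Xs s) xhat by [rewrite Xs_cap]; apply.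
have S_nested j s : Xs_ j s.+1 `<=` Xs_ j s.
  apply: (block_prod_subset _ _ _ (fun j => Xs_ j s.+1) (fun j => Xs_ j s) xhat).
    by rewrite -XsE.
  by rewrite -!XsE; exact: (Xs_nested s).1.
suff : Xs (cycles K recv tau k) (x i k) by case.
rewrite XsE; apply: in_cycles_level xP _ _ _ _ i k => //.
  by move=> s y j; rewrite -XsE; exact: theta_next.
move=> j; rewrite -XsE; split; first exact: x0.
rewrite expr0 mul1r.
exact: (le_bigmax _ (fun j => nrm (x j 0%N - xhat))).
Qed.
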